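(* Let $k\geq2$, let $G$ be a $k$-chromatic $3$-graph of order $n$, and let $p\geq1$. (I) If $n\leq 2k$, then $\lambda^{(p)}(G)<3!\binom{n}{3}n^{-3/p}$, unless $G=K_n^3$. (II) If $n>2k$, then \[ \lambda^{(p)}(G)<3!\left(\binom{n}{3}-k\binom{n/k}{3}\right)n^{-3/p}, \] unless $k\mid n$ and $G=Q_k^3(n)$.
   Context: A $3$-graph of order $n$ is a $3$-uniform hypergraph with vertex set $[n]$. Its polynomial form is $P_G([x_i])=3!\sum_{\{i_1,i_2,i_3\}\in E(G)}x_{i_1}x_{i_2}x_{i_3}$, and for real $p\geq1$ its $p$-spectral radius is $\lambda^{(p)}(G)=\max_{|x_1|^p+\cdots+|x_n|^p=1}P_G([x_i])$. A $3$-graph is $k$-chromatic if its vertex set can be partitioned into $k$ sets so that no set contains an edge; an edge-maximal $k$-chromatic $3$-graph is complete $k$-chromatic. $Q_k^3(n)$ denotes the complete $k$-chromatic $3$-graph of order $n$ with vertex classes of sizes $\lfloor n/k\rfloor$ or $\lceil n/k\rceil$. $K_n^3$ is the complete $3$-graph of order $n$. For real $x$, $\binom{x}{3}=x(x-1)(x-2)/6$. *)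

(* Defs.v *)
From mathcomp Require Import all_boot all_order all_algebra.
From mathcomp Require Import all_classical all_reals all_analysis.
Set Implicit Arguments.
Unset Strict Implicit.
Unset Printing Implicit Defensive.
Import Order.TTheory GRing.Theory Num.Theory.
Import numFieldNormedType.Exports.
Local Open Scope classical_set_scope.
Local Open Scope ring_scope.

(* A 3-graph of order n is given by its set of edges; the vertex set is 'I_n. *)
Definition is_3graph (n : nat) (G : {set {set 'I_n}}) : Prop :=
  forall e, e \in G -> #|e| = 3%N.

Definition complete_3graph (n : nat) : {set {set 'I_n}} :=
  [set e : {set 'I_n} | #|e| == 3%N]%SET.

Definition color_class (n k : nat) (f : 'I_n -> 'I_k) (j : 'I_k) : {set 'I_n} :=
  [set i | f i == j]%SET.

(* The partition of 'I_n into k (possibly empty) sets is presented as the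
   family of fibres of f : 'I_n -> 'I_k. *)
Definition proper_coloring (n k : nat) (G : {set {set 'I_n}})
    (f : 'I_n -> 'I_k) : Prop :=
  forall (j : 'I_k) e, e \in G -> ~~ (e \subset color_class f j).

Definition chromatic (n k : nat) (G : {set {set 'I_n}}) : Prop :=
  exists f : 'I_n -> 'I_k, proper_coloring G f.

Definition complete_chromatic (n k : nat) (G : {set {set 'I_n}}) : Prop :=
  [/\ is_3graph G, chromatic k G &
      forall H : {set {set 'I_n}},
        is_3graph H -> chromatic k H -> G \subset H -> H = G].

(* G is (a labelled copy on 'I_n of) Q_k^3(n). The quotient (n + k.-1) %/ k is
   the ceiling of n / k. *)
Definition is_Q3 (n k : nat) (G : {set {set 'I_n}}) : Prop :=
  complete_chromatic k G /\
  exists2 f : 'I_n -> 'I_k, proper_coloring G f &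
    forall j, #|color_class f j| = (n %/ k)%N \/
              #|color_class f j| = ((n + k.-1) %/ k)%N.

Definition polyform (R : realType) (n : nat) (G : {set {set 'I_n}})
    (x : 'rV[R]_n) : R :=
  3`!%:R * \sum_(e in G) \prod_(i in e) x 0 i.

Definition psphere (R : realType) (n : nat) (p : R) : set 'rV[R]_n :=
  [set x | \sum_(i < n) `|x 0 i| `^ p = 1].
Arguments psphere {R} n p.

(* For 0 < n and 1 <= p the supremum is attained: see pspectral_radius_max. *)
Definition pspectral_radius (R : realType) (n : nat) (p : R)
    (G : {set {set 'I_n}}) : R :=
  sup [set polyform G x | x in psphere n p].

Definition binom3 (R : realType) (x : R) : R := x * (x - 1) * (x - 2) / 6.

Lemma continuous_normr_powR (R : realType) (p : R) : 1 <= p ->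
  continuous (fun t : R => `|t| `^ p).
Proof.
move=> p1 t; have p0 : 0 < p by apply: lt_le_trans p1.
have [->|t0] := eqVneq t 0.
  rewrite /continuous_at normr0 powR0 ?gt_eqF//.
  apply/cvgrPdist_lt => e e0.
  have ep : 0 < e `^ p^-1 by rewrite powR_gt0.
  have hs : \forall s \near (0 : R), `|s| < e `^ p^-1.
    by apply: nbhs0_lt.
  apply: filterS hs => s hs.
  rewrite sub0r normrN (ger0_norm (powR_ge0 _ _)).
  have -> : e = (e `^ p^-1) `^ p.
    by rewrite -powRrM mulVf ?gt_eqF// powRr1 ?ltW.
  by apply: gt0_ltr_powR; rewrite ?nnegrE ?normr_ge0// ltW.
have nt : 0 < `|t| by rewrite normr_gt0.
apply: (@continuous_comp R R R (fun t : R => `|t|) (fun s => s `^ p)).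
  exact: norm_continuous.
apply: differentiable_continuous; apply/derivable1_diffP.
by apply: derivable_powR; rewrite in_itv/= nt.
Qed.

Lemma psphere_compact (R : realType) (n : nat) (p : R) : 1 <= p ->
  compact (psphere n p).
Proof.
move=> p1; have p0 : 0 < p by apply: lt_le_trans p1.
apply: bounded_closed_compact.
  exists 1; split; first exact: real1.
  move=> M M1 x /= sx; rewrite /Num.norm /= mx_normrE.
  apply: bigmax_le => [|[i j] _ /=]; first exact/ltW/(lt_trans ltr01).
  rewrite (le_trans _ (ltW M1))// leNgt; apply/negP => x1.
  have : `|x i j| `^ p <= 1.
    rewrite -sx (bigD1 j) //= (ord1 i) lerDl.
    by apply: sumr_ge0 => *; exact: powR_ge0.
  rewrite leNgt => /negP; apply.
  have -> : 1 = 1 `^ p :> R by rewrite powR1.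
  by apply: gt0_ltr_powR; rewrite ?nnegrE ?ler01 ?normr_ge0.
apply: (@preimage_closed _ _ (fun x : 'rV[R]_n => \sum_(i < n) `|x 0 i| `^ p)
          [set 1]); last exact: closed_eq.
move=> x _; move: x.
apply: continuous_big => [|i _ x]; first exact: add_continuous.
apply: (@continuous_comp 'rV[R]_n R R (fun x => x 0 i) (fun t => `|t| `^ p)).
  exact: coord_continuous.
exact: continuous_normr_powR.
Qed.

Lemma polyform_continuous (R : realType) (n : nat) (G : {set {set 'I_n}}) :
  continuous (@polyform R n G).
Proof.
move=> x.
apply: (@continuousM R 'rV[R]_n (cst 3`!%:R)
  (fun x => \sum_(e in G) \prod_(i in e) x 0 i)); first exact: cst_continuous.
move: x; apply: continuous_big => [|e _]; first exact: add_continuous.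
apply: continuous_big => [|i _]; first exact: mul_continuous.
exact: coord_continuous.
Qed.

Lemma pspectral_radius_max (R : realType) (n : nat) (p : R)
    (G : {set {set 'I_n}}) : (0 < n)%N -> 1 <= p ->
  exists2 x, psphere n p x & polyform G x = pspectral_radius p G /\
    forall y, psphere n p y -> polyform G y <= polyform G x.
Proof.
case: n G => // n G _ p1; have p0 : 0 < p by apply: lt_le_trans p1.
have S0 : psphere n.+1 p !=set0.
  exists (\row_i (i == ord0)%:R).
  rewrite /psphere /= (bigD1 ord0) //= big1 => [|i /negbTE i0].
    by rewrite mxE eqxx normr1 powR1 addr0.
  by rewrite mxE i0 normr0 powR0 ?gt_eqF.
have [|x xS xmax] := EVT_max_rV S0 (psphere_compact p1) (f := @polyform R _ G).
  by apply: continuous_subspaceT; exact: polyform_continuous.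
rewrite inE in xS; exists x => //.
have H y : psphere n.+1 p y -> polyform G y <= polyform G x.
  by move=> yS; apply: xmax; rewrite inE.
split=> //; apply/eqP; rewrite eq_le; apply/andP; split.
  apply: ub_le_sup; last by exists x.
  by exists (polyform G x) => _ [y yS <-]; exact: H.
apply: ge_sup; first by exists (polyform G x), x.
by move=> _ [y yS <-]; exact: H.
Qed.

(* Main.v *)
(**
By Bernoulli's inequality a nonnegative vector of [p]-norm 1 has mean at most
[n^(-1/p)], so after rescaling it suffices to bound the polynomial form at
[y >= 0] with [\sum_i y i = n].  There (I) is Maclaurin's inequality.

For (II), let [s_j], [Q_j], [u_j] be the sum of the [y i], the sum of the
[y i ^+ 2] and the size of the [j]-th colour class.  Expressing third elementary
symmetric polynomials by power sums bounds the form by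
[n^3 - \sum_j (s_j^3 + 3 (n - s_j) Q_j)].  With [m = n / k], [c^2 = n - m] and
[w_j^2 = n - s_j], expanding [\sum (w_j y_i - c)^2 >= 0] over a class gives
[(n - s_j) Q_j >= 2 c s_j w_j - c^2 u_j].  The resulting function
[s^3 + 6 c s w] of [s = s_j] lies above its tangent line at [m]; this is where
[n > 2k] is used.  Equality forces [y = 1] and [u_j = m], and then
edge-maximality of [G] follows by comparing edge numbers.
*)
Require Import Defs.
From mathcomp Require Import all_boot all_order all_algebra.
From mathcomp Require Import all_classical all_reals all_analysis.
From mathcomp Require Import ring lra.
Import Order.TTheory GRing.Theory Num.Theory.
Local Open Scope ring_scope.

(** * Third elementary symmetric polynomials and power sums *)

(** The coefficients of this product are the elementary symmetric polynomials. They are treated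
    together because a new factor feeds each coefficient into the next. *)
Lemma coef_prod_1DZX (R : comNzRingType) (I : Type) (r : seq I) (y : I -> R) :
  let P := \prod_(i <- r) (1 + y i *: 'X) in
  let S := \sum_(i <- r) y i in
  let Q := \sum_(i <- r) y i ^+ 2 in
  let C := \sum_(i <- r) y i ^+ 3 in
  [/\ P`_0 = 1, P`_1 = S, 2 * P`_2 = S ^+ 2 - Q &
      6 * P`_3 = S ^+ 3 - 3 * S * Q + 2 * C].
Proof.
elim: r => [|a r] /=.
  by rewrite !big_nil !coef1 /=; split=> //; ring.
rewrite !big_cons; move: (\prod_(_ <- _) _) (\sum_(_ <- _) y _)
  (\sum_(_ <- _) _ ^+ 2) (\sum_(_ <- _) _ ^+ 3) => P S Q C [e0 e1 e2 e3].
have coefE n : ((1 + y a *: 'X) * P)`_n = P`_n + y a * ('X * P)`_n.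
  by rewrite mulrDl mul1r coefD -scalerAl coefZ.
rewrite !coefE !coefXM /= e0 e1.
split; [ring | ring | |].
- by rewrite mulrDr e2; ring.
- have -> : 6 * (P`_3 + y a * P`_2) = 6 * P`_3 + 3 * y a * (2 * P`_2) by ring.
  by rewrite e2 e3; ring.
Qed.

Lemma prod_1DZX (R : comNzRingType) (T : finType) (y : T -> R) :
  \prod_i (1 + y i *: 'X) =
  \sum_(e : {set T}) (\prod_(i in e) y i) *: 'X^#|e|.
Proof.
under eq_bigr do rewrite addrC.
rewrite bigA_distr; apply: eq_bigr => e _.
by rewrite -big_mkcond /= scaler_prod prodr_const.
Qed.

(** Both sides compute the coefficient of ['X^3] in the product of the [1 + y i *: 'X]. *)
Lemma esym3_power_sums (R : comNzRingType) (T : finType) (y : T -> R) :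
  6 * (\sum_(e : {set T} | #|e| == 3%N) \prod_(i in e) y i) =
  (\sum_i y i) ^+ 3 - 3 * (\sum_i y i) * (\sum_i y i ^+ 2) +
  2 * \sum_i y i ^+ 3.
Proof.
have [_ _ _ <-] := coef_prod_1DZX R T (index_enum T) y.
rewrite prod_1DZX coef_sum big_mkcond /=; congr (_ * _); apply: eq_bigr => e _.
by rewrite coefZ coefXn eq_sym; case: eqP => _; rewrite ?mulr1 ?mulr0.
Qed.

(** * Scalar inequalities *)

(** With [s = c ^+ 2 + m - w ^+ 2], this is the cofactor of [(s - m) ^+ 2] in the tangent-line
    remainder below. The cases [c <= w] and [w < c] mean [s <= m] and [s > m]. *)
Lemma class_gap_gt0 (R : realFieldType) (m c w : R) :
  2 <= m -> m <= c ^+ 2 -> (4 <= c ^+ 2) || (5 / 2 <= m) ->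
  0 < c -> 0 <= w -> w ^+ 2 <= c ^+ 2 + m ->
  0 < (3 * m + c ^+ 2 - w ^+ 2) * (w + c) ^+ 2 - 3 * m - 6 * c * (w + c).
Proof.
move=> m2 mc mk c0 w0 ws.
have [cw|wc] := leP c w.
  have h1 : 4 * c ^+ 2 <= (w + c) ^+ 2 by nra.
  have h2 : 2 * c * (w + c) <= (w + c) ^+ 2 by nra.
  have h3 : 2 * m <= 3 * m + c ^+ 2 - w ^+ 2 by lra.
  have h4 : 4 * (w + c) ^+ 2 <= (3 * m + c ^+ 2 - w ^+ 2) * (w + c) ^+ 2.
    by rewrite ler_wpM2r ?sqr_ge0//; lra.
  nra.
have cc : 0 < c ^+ 2 by rewrite exprn_gt0.
have cw0 : 0 <= c * w by rewrite mulr_ge0 ?(ltW c0).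
have cw1 : 0 <= c ^+ 2 - c * w by rewrite expr2 -mulrBr mulr_ge0 ?subr_ge0 ?ltW.
have h1 : c ^+ 2 * (c ^+ 2 - c * w) <= (c ^+ 2 - w ^+ 2) * (w + c) ^+ 2.
  have -> : (c ^+ 2 - w ^+ 2) * (w + c) ^+ 2 = (c - w) * (w + c) ^+ 3 by ring.
  have -> : c ^+ 2 * (c ^+ 2 - c * w) = (c - w) * c ^+ 3 by ring.
  by rewrite ler_wpM2l ?lerXn2r ?nnegrE; lra.
have -> : (3 * m + c ^+ 2 - w ^+ 2) * (w + c) ^+ 2 =
  3 * m * (c ^+ 2 + 2 * (c * w) + w ^+ 2) + (c ^+ 2 - w ^+ 2) * (w + c) ^+ 2.
  by ring.
have h2 : 0 <= m * w ^+ 2 by rewrite mulr_ge0 ?sqr_ge0; lra.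
have h3 : 6 * c * (w + c) = 6 * (c * w) + 6 * c ^+ 2 by ring.
rewrite h3; move: h1 h2; move: (_ * (w + c) ^+ 2) => z.
(* With the monomials as independent variables, the goal becomes linear once each product is bounded
   by a constant multiple; the disjunction supplies the constants. *)
move: (w ^+ 2) (c ^+ 2) (c * w) cc cw0 cw1 mc mk {ws h3} => w2 a b.
move=> cc cw0 cw1 mc /orP[] h h1 h2.
  have h3 : 2 * a <= m * a by rewrite ler_wpM2r// ltW.
  have h4 : 2 * b <= m * b by rewrite ler_wpM2r.
  have h5 : 4 * (a - b) <= a * (a - b) by rewrite ler_wpM2r.
  lra.
have h3 : 5 / 2 * a <= m * a by rewrite ler_wpM2r// ltW.
have h4 : 5 / 2 * b <= m * b by rewrite ler_wpM2r.
have h5 : 5 / 2 * (a - b) <= a * (a - b) by rewrite ler_wpM2r//; lra.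
lra.
Qed.

(* [D] is the excess of a class over the tangent plane at [(s, u) = (m, m)];
   the coefficient of [s - m] is the derivative at [m] of
   [s^3 + 6 c s sqrt (c^2 + m - s)]. *)
Lemma tangent_class (R : realFieldType) (m c w s u Q : R) :
  2 <= m -> m <= c ^+ 2 -> (4 <= c ^+ 2) || (5 / 2 <= m) ->
  0 < c -> 0 <= w -> w ^+ 2 = c ^+ 2 + m - s -> 0 <= s ->
  2 * c * s * w - c ^+ 2 * u <= w ^+ 2 * Q ->
  let D := s ^+ 3 + 3 * w ^+ 2 * Q - m ^+ 3 - 3 * m * c ^+ 2
    - (3 * m ^+ 2 + 6 * c ^+ 2 - 3 * m) * (s - m) + 3 * c ^+ 2 * (u - m) in
  0 <= D /\ (D = 0 -> s = m /\ w ^+ 2 * Q = 2 * c * s * w - c ^+ 2 * u).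
Proof.
move=> m2 mc mk c0 w0 ws s0 hQ D.
have gap := class_gap_gt0 R m c w m2 mc mk c0 w0 ltac:(lra).
set E := (X in 0 < X) in gap.
have z0 : 0 < w + c by lra.
pose D1 := s ^+ 3 - m ^+ 3 + 6 * c * (s * w - m * c)
  - (3 * m ^+ 2 + 6 * c ^+ 2 - 3 * m) * (s - m).
have eD : D = D1 + 3 * (w ^+ 2 * Q - (2 * c * s * w - c ^+ 2 * u)).
  by rewrite /D /D1; ring.
(* Since [s - m = (c - w) * (c + w)], multiplying by [(w + c) ^+ 2] turns the remainder into a
   polynomial with the double root [s = m] split off. *)
have eD1 : D1 * (w + c) ^+ 2 = (s - m) ^+ 2 * E.
  rewrite /D1 /E; have -> : s = c ^+ 2 + m - w ^+ 2 by lra.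
  by ring.
have D1_ge0 : 0 <= D1.
  rewrite -(@pmulr_lge0 _ ((w + c) ^+ 2)) ?exprn_gt0// eD1.
  by rewrite mulr_ge0 ?sqr_ge0 ?ltW.
split; first lra.
move=> D0; have D10 : D1 = 0 by lra.
split; last lra.
move: eD1; rewrite D10 mul0r => /esym/eqP.
by rewrite mulf_eq0 (gt_eqF gap) orbF sqrf_eq0 subr_eq0 => /eqP.
Qed.

Lemma bernoulli_powR (R : realType) (p y : R) : 1 <= p -> 0 <= y ->
  p * y <= y `^ p + p - 1.
Proof.
move=> p1 y0; have [->|pn1] := eqVneq p 1; first by rewrite powRr1 //; lra.
have lt1p : 1 < p by rewrite lt_neqAle eq_sym pn1.
have q0 : 0 < p / (p - 1) by rewrite divr_gt0; lra.
(* Young's inequality with second factor [1] *)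
have := @conjugate_powR R y 1 p (p / (p - 1)) y0 ler01 ltac:(lra) q0.
rewrite mulr1 powR1 => /(_ _)/wrap[|h].
  by field; rewrite ?subr_eq0 pn1 /=; lra.
have -> : y `^ p + p - 1 = p * (y `^ p / p + 1 / (p / (p - 1))).
  by field; rewrite ?subr_eq0 pn1 /=; lra.
by rewrite ler_pM2l //; lra.
Qed.

(** * Bounds for the form at nonnegative vectors *)

Lemma natr_bin3 (R : comNzRingType) (n : nat) :
  6 * 'C(n, 3)%:R = n%:R * (n%:R - 1) * (n%:R - 2) :> R.
Proof.
elim: n => [|n IH]; first by rewrite bin0n mulr0 !mul0r.
have bin2E : 2 * 'C(n, 2)%:R = n%:R * (n%:R - 1) :> R.
  elim: n {IH} => [|n IH]; first by rewrite bin0n mulr0 !mul0r.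
  by rewrite binS bin1 natrD mulrDr IH -natr1; ring.
rewrite binS natrD mulrDr IH -natr1.
have -> : 6 * 'C(n, 2)%:R = 3 * (2 * 'C(n, 2)%:R) :> R by ring.
by rewrite bin2E; ring.
Qed.

(** No edge lies inside a class, and a triple lies inside at most one class. Hence the sum over
    edges is at most the sum over all triples minus the sums over triples within each class. *)
Lemma graph_sum_le_classes (R : realType) (n k : nat) (G : {set {set 'I_n}})
    (f : 'I_n -> 'I_k) (y : 'I_n -> R) :
  is_3graph G -> proper_coloring G f -> (forall i, 0 <= y i) ->
  6 * (\sum_(e in G) \prod_(i in e) y i) <=
  (\sum_i y i) ^+ 3 - \sum_j ((\sum_(i | f i == j) y i) ^+ 3 +
    3 * (\sum_i y i - \sum_(i | f i == j) y i) * \sum_(i | f i == j) y i ^+ 2).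
Proof.
move=> hG hf y0; set S := \sum_i y i.
pose W (e : {set 'I_n}) := \prod_(i in e) y i.
have W0 e : 0 <= W e by apply: prodr_ge0.
(* Extending by zero off class [j] lets [esym3_power_sums] on all of ['I_n] handle a single
   class. *)
pose z j i := if f i == j then y i else 0.
have zE j (e : {set 'I_n}) :
      \prod_(i in e) z j i = if e \subset color_class f j then W e else 0.
  case: ifPn => [/fintype.subsetP ej|/fintype.subsetPn[i ie nij]].
    by apply: eq_bigr => i /ej; rewrite inE /z => ->.
  move: nij; rewrite (bigD1 i)//= /z inE => /negbTE ->.
  by rewrite mul0r.
have key : \sum_(e in G) W e <= \sum_(e : {set 'I_n} | #|e| == 3%N) W e -
    \sum_j \sum_(e : {set 'I_n} | #|e| == 3%N) \prod_(i in e) z j i.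
  rewrite exchange_big /= -sumrB big_mkcond [leRHS]big_mkcond /=.
  apply: ler_sum => e _; case: ifPn => [eG|eG].
    rewrite hG// eqxx big1 ?subr0// => j _.
    by rewrite zE (negbTE (hf j e eG)).
  case: eqP => // e3; rewrite subr_ge0.
  have [j ej|ne] := pickP (fun j => e \subset color_class f j); last first.
    by rewrite big1// => j _; rewrite zE ne.
  rewrite (bigD1 j)//= zE ej big1 ?addr0// => l lj; rewrite zE.
  have /card_gt0P[i ie] : (0 < #|e|)%N by rewrite e3.
  case: ifPn => // /fintype.subsetP/(_ i ie); rewrite inE => /eqP il.
  by move/fintype.subsetP/(_ i ie): ej; rewrite inE il (negbTE lj).
apply: le_trans (ler_wpM2l (ler0n R 6) key) _.
rewrite mulrBr [6 * _](esym3_power_sums R 'I_n y) [6 * _]mulr_sumr.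
rewrite (eq_bigr _ (fun j _ => esym3_power_sums R 'I_n (z j))).
have sumz j : \sum_i z j i = \sum_(i | f i == j) y i by rewrite [RHS]big_mkcond.
(* The exponent is a successor because [0 ^+ 0 = 1]. *)
have sumzX r j : \sum_i z j i ^+ r.+1 = \sum_(i | f i == j) y i ^+ r.+1.
  rewrite [RHS]big_mkcond; apply: eq_bigr => i _.
  by rewrite /z; case: ifP; rewrite ?expr0n.
have partX r : \sum_i y i ^+ r = \sum_j \sum_(i | f i == j) y i ^+ r.
  by rewrite (partition_big f xpredT).
rewrite -/S (partX 2) (partX 3) [3 * S * _]mulr_sumr [2 * _]mulr_sumr.
rewrite -addrA -addrA lerD2l -sumrN -sumrN -sumrN -big_split -big_split /=.
rewrite le_eqVlt; apply/orP; left; apply/eqP; apply: eq_bigr => j _.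
by rewrite sumz !sumzX; ring.
Qed.

Lemma sum_sqr_affine (R : comNzRingType) (I : finType) (P : pred I)
    (y : I -> R) (a b : R) :
  \sum_(i | P i) (a * y i - b) ^+ 2 =
  a ^+ 2 * (\sum_(i | P i) y i ^+ 2) - 2 * a * b * (\sum_(i | P i) y i)
  + b ^+ 2 * #|P|%:R.
Proof.
rewrite !mulr_sumr mulr_natr -sumr_const -sumrN -!big_split /=.
by apply: eq_bigr => i _; ring.
Qed.

(** The deficit times [n - 1] is a sum of nonnegative terms [H i], each of which vanishes only if
    [y i = 1]. *)
Lemma maclaurin3 (R : realType) (n : nat) (y : 'I_n -> R) :
  (2 < n)%N -> (forall i, 0 <= y i) -> \sum_i y i = n%:R ->
  let e3 := 6 * \sum_(e : {set 'I_n} | #|e| == 3%N) \prod_(i in e) y i in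
  e3 <= 6 * 'C(n, 3)%:R /\ (6 * 'C(n, 3)%:R <= e3 -> forall i, y i = 1).
Proof.
move=> n3 y0 yn; rewrite /= natr_bin3 esym3_power_sums yn.
have N3 : 3 <= n%:R :> R by rewrite ler_nat.
set N := n%:R in N3 yn *; set Q := \sum_i _ ^+ 2; set C := \sum_i _ ^+ 3.
have sumD i (F : 'I_n -> R) : \sum_(l | l != i) F l = \sum_l F l - F i.
  by rewrite [X in _ = X - _](bigD1 i)//= addrAC subrr add0r.
have yN i : y i <= N.
  by rewrite -yn (bigD1 i)//= lerDl sumr_ge0.
have cauchy i : (N - y i) ^+ 2 <= (N - 1) * (Q - y i ^+ 2).
  have : 0 <= \sum_(l | l != i) ((N - 1) * y l - (N - y i)) ^+ 2.
    by apply: sumr_ge0 => l _; exact: sqr_ge0.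
  rewrite sum_sqr_affine !sumD -/Q yn cardC1 card_ord -subn1.
  rewrite natrB ?(ltn_trans _ n3)// -/N.
  rewrite (_ : _ + _ = (N - 1) * ((N - 1) * (Q - y i ^+ 2) - (N - y i) ^+ 2)).
    by rewrite pmulr_rge0 ?subr_ge0//; lra.
  by ring.
(* The first part is [y i] times the slack in [cauchy]. The cubic added to it matches the
   coefficients of [Q] and [C] in the deficit; it is nonnegative as [y i <= N < 2 * N - 2]. *)
pose H i := ((N - 1) * (y i * (Q - y i ^+ 2)) - y i * (N - y i) ^+ 2)
  + (N - 2) * ((y i - 1) ^+ 2 * (2 * N - 2 - y i)).
have E0 i : 0 <= (N - 1) * (y i * (Q - y i ^+ 2)) - y i * (N - y i) ^+ 2.
  by have := ler_wpM2l (y0 i) (cauchy i); lra.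
have F0 i : 0 <= (y i - 1) ^+ 2 * (2 * N - 2 - y i).
  by rewrite mulr_ge0 ?sqr_ge0//; have := yN i; lra.
have H0 i : 0 <= H i by rewrite addr_ge0// mulr_ge0//; lra.
have sumH : \sum_i H i =
    (N - 1) * (N * (N - 1) * (N - 2) - (N ^+ 3 - 3 * N * Q + 2 * C)).
  have -> : \sum_i H i = \sum_i (((N - 1) * Q - N ^+ 2 - (N - 2) * N ^+ 2
      + (N - 1) * (N - 2) * (N - 3)) * y i + (2 * N * (N - 1)) * y i ^+ 2
      - (2 * (N - 1)) * y i ^+ 3 + 2 * (N - 1) * (N - 2)).
    by apply: eq_bigr => i _; rewrite /H; ring.
  rewrite !big_split /= sumrN -!mulr_sumr -/Q -/C yn sumr_const cardT.
  by rewrite size_enum_ord -mulr_natr -/N; ring.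
have sumH0 : 0 <= \sum_i H i by rewrite sumr_ge0.
have N1 : 0 < N - 1 by lra.
split; first by move: sumH0; rewrite sumH pmulr_rge0// subr_ge0.
move=> le i; have sH : \sum_i H i = 0.
  apply/eqP; rewrite eq_le sumH0 andbT sumH.
  by rewrite pmulr_rle0// subr_le0.
have := psumr_eq0P (fun i _ => H0 i) sH (i := i) isT; rewrite /H => Hi.
have := E0 i; have := F0 i; have := yN i => h1 h2 h3.
have /eqP : (N - 2) * ((y i - 1) ^+ 2 * (2 * N - 2 - y i)) = 0.
  have : 0 <= (N - 2) * ((y i - 1) ^+ 2 * (2 * N - 2 - y i)).
    by rewrite mulr_ge0//; lra.
  lra.
rewrite mulf_eq0 mulf_eq0 sqrf_eq0 subr_eq0 => /or3P[|/eqP//|] /eqP; lra.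
Qed.

(** * Rescaling from the sphere to vectors of sum [n] *)

(** The form is homogeneous of degree 3, so rescaling a maximizer costs a factor [t^-1 ^+ 3].
    Attainment of the maximum keeps the inequality strict. *)
Lemma pspectral_radius_lt (R : realType) (n : nat) (G : {set {set 'I_n}})
    (p B : R) : (0 < n)%N -> 1 <= p -> is_3graph G ->
  (forall y : 'I_n -> R, (forall i, 0 <= y i) -> \sum_i y i = n%:R ->
    3`!%:R * (\sum_(e in G) \prod_(i in e) y i) < B) ->
  pspectral_radius p G < B * n%:R `^ (- (3 / p)).
Proof.
move=> n0 p1 hG hB.
have [x xS [<- _]] := pspectral_radius_max G n0 p1; rewrite /polyform.
have N0 : 0 < n%:R :> R by rewrite ltr0n.
have p0 : 0 < p by lra.
pose a i := `|x 0 i|; have a0 i : 0 <= a i by exact: normr_ge0.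
pose s := \sum_i a i.
have s0 : 0 < s.
  rewrite lt_neqAle sumr_ge0// andbT; apply/eqP => /esym s0.
  have := psumr_eq0P (fun i _ => a0 i) s0 => az.
  have : \sum_(i < n) `|x 0 i| `^ p = 0.
    by rewrite big1// => i _; rewrite [`|_|]az// powR0 ?gt_eqF.
  by rewrite xS => /eqP; rewrite oner_eq0.
pose t := n%:R / s; have t0 : 0 < t by rewrite divr_gt0.
pose y i := t * a i.
have y0 i : 0 <= y i by rewrite mulr_ge0// ltW.
have yn : \sum_i y i = n%:R by rewrite -mulr_sumr -/s divfK ?gt_eqF.
have tp : n%:R <= t `^ p.
  have : \sum_i p * y i <= \sum_i (y i `^ p + (p - 1)).
    by apply: ler_sum => i _; rewrite addrA; exact: bernoulli_powR.
  rewrite -mulr_sumr yn big_split /= sumr_const cardT size_enum_ord.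
  have -> : \sum_i y i `^ p = t `^ p.
    under eq_bigr => i _ do rewrite powRM ?(ltW t0)//.
    by rewrite -mulr_sumr xS mulr1.
  by rewrite -mulr_natr; lra.
have tn : t^-1 <= n%:R `^ (- p^-1).
  rewrite powRN lef_pV2 ?posrE ?powR_gt0//.
  have -> : t = (t `^ p) `^ p^-1.
    by rewrite -powRrM divff ?gt_eqF// powRr1// ltW.
  by rewrite ge0_ler_powR ?nnegrE ?invr_ge0 ?powR_ge0// ltW.
have t3 : t^-1 ^+ 3 <= n%:R `^ (- (3 / p)).
  have -> : - (3 / p) = - p^-1 * 3%:R by ring.
  rewrite powRrM powR_mulrn ?powR_ge0//.
  by rewrite lerXn2r ?nnegrE ?powR_ge0 ?invr_ge0 ?(ltW t0).
have By := hB y y0 yn.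
(* The sign of [B] is needed to multiply it into [t3]. *)
have B0 : 0 <= B.
  apply: le_trans (ltW By); rewrite mulr_ge0 ?ler0n// sumr_ge0// => e _.
  exact: prodr_ge0.
have Gx : \sum_(e in G) \prod_(i in e) x 0 i <=
    \sum_(e in G) \prod_(i in e) a i.
  apply: ler_sum => e _; rewrite (le_trans (ler_norm _))//.
  by rewrite normr_prod.
have Ga : \sum_(e in G) \prod_(i in e) a i =
    t^-1 ^+ 3 * \sum_(e in G) \prod_(i in e) y i.
  rewrite mulr_sumr; apply: eq_bigr => e /hG e3.
  rewrite big_split /= prodr_const [#|_|]e3 mulrA -exprMn mulVf ?gt_eqF//.
  by rewrite expr1n mul1r.
apply: le_lt_trans (ler_wpM2l (ler0n R _) Gx) _.
rewrite Ga mulrCA mulrC; apply: lt_le_trans (_ : B * t^-1 ^+ 3 <= _).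
  by rewrite ltr_pM2r// exprn_gt0// invr_gt0.
exact: ler_wpM2l.
Qed.

(** * The bound for chromatic graphs and its equality case *)

Lemma chromatic_graph_sum_le (R : realType) (n k : nat) (G : {set {set 'I_n}})
    (f : 'I_n -> 'I_k) (y : 'I_n -> R) :
  (2 <= k)%N -> (2 * k < n)%N -> is_3graph G -> proper_coloring G f ->
  (forall i, 0 <= y i) -> \sum_i y i = n%:R ->
  let B := 6 * ('C(n, 3)%:R - k%:R * binom3 (n%:R / k%:R)) in
  let P := 6 * \sum_(e in G) \prod_(i in e) y i in
  P <= B /\ (B <= P -> (forall i, y i = 1) /\
                       (forall j, #|color_class f j|%:R = n%:R / k%:R :> R)).
Proof.
move=> k2 kn hG hf y0 yn B P.
have := graph_sum_le_classes R n k G f y hG hf y0; rewrite -/P yn => hP0.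
pose s j := \sum_(i | f i == j) y i.
pose Q j := \sum_(i | f i == j) y i ^+ 2.
pose N : R := n%:R; pose K : R := k%:R; pose m := N / K.
pose F j := s j ^+ 3 + 3 * (N - s j) * Q j.
have {hP0} hP : P <= N ^+ 3 - \sum_j F j := hP0.
have K2 : 2 <= K by rewrite ler_nat.
have KN : 2 * K + 1 <= N by rewrite -natrM natr1 ler_nat.
have mK : m * K = N by rewrite divfK//; lra.
have m2 : 2 <= m by rewrite ler_pdivlMr; lra.
pose c := Num.sqrt (N - m).
have Nm : m <= N - m by nra.
have c2 : c ^+ 2 = N - m by rewrite sqr_sqrtr; lra.
have c0 : 0 < c by rewrite sqrtr_gt0; lra.
(* For [k >= 3], [n >= 7] gives [c ^+ 2 >= 2 * n / 3 > 4]; for [k = 2], [n >= 5] gives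
   [m >= 5 / 2]. *)
have mk : (4 <= c ^+ 2) || (5 / 2 <= m).
  have [k3|] := leqP 3 k.
    have K3 : 3 <= K by rewrite ler_nat.
    by apply/orP; left; rewrite c2; nra.
  rewrite ltnS => k2'; have Ke : K = 2.
    by rewrite /K (_ : k = 2%N)//; apply/eqP; rewrite eqn_leq k2 k2'.
  by apply/orP; right; rewrite ler_pdivlMr Ke//; lra.
have s0 j : 0 <= s j by rewrite sumr_ge0.
have ssum : \sum_j s j = N by rewrite -[N]yn [RHS](partition_big f xpredT).
have sN j : s j <= N by rewrite -ssum (bigD1 j)//= lerDl sumr_ge0.
pose u j : R := #|color_class f j|%:R.
have usum : \sum_j u j = N.
  rewrite -natr_sum; congr (_%:R); rewrite -[RHS]card_ord -[RHS]sum1_card.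
  rewrite [RHS](partition_big f xpredT)//=.
  apply: eq_bigr => j _; rewrite -sum1_card.
  by apply: eq_bigl => i; rewrite inE.
pose w j := Num.sqrt (N - s j).
have w2 j : w j ^+ 2 = c ^+ 2 + m - s j.
  by rewrite sqr_sqrtr; [rewrite c2; ring | rewrite subr_ge0].
have sqE j : \sum_(i | f i == j) (w j * y i - c) ^+ 2 =
    w j ^+ 2 * Q j - (2 * c * s j * w j - c ^+ 2 * u j).
  rewrite sum_sqr_affine -/(s j) -/(Q j) /u.
  rewrite (_ : #|_| = #|color_class f j|); first by ring.
  by apply: eq_card => i; rewrite inE.
have sq0 j i : f i == j -> 0 <= (w j * y i - c) ^+ 2 by rewrite sqr_ge0.
have hQ j : 2 * c * s j * w j - c ^+ 2 * u j <= w j ^+ 2 * Q j.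
  by rewrite -subr_ge0 -sqE sumr_ge0// => i _; exact: sqr_ge0.
pose D j := s j ^+ 3 + 3 * w j ^+ 2 * Q j - m ^+ 3 - 3 * m * c ^+ 2
    - (3 * m ^+ 2 + 6 * c ^+ 2 - 3 * m) * (s j - m) + 3 * c ^+ 2 * (u j - m).
have tD j := tangent_class R m c (w j) (s j) (u j) (Q j) m2
  ltac:(lra) mk c0 (sqrtr_ge0 _) (w2 j) (s0 j) (hQ j).
have D0 j : 0 <= D j by case: (tD j).
(* The linear terms cancel on summation, since the [s j] and the [u j] both add up to
   [n = k * m]. *)
have sumD : \sum_j D j = B - (N ^+ 3 - \sum_j F j).
  have -> : \sum_j D j = \sum_j F j
      + - (3 * m ^+ 2 + 6 * c ^+ 2 - 3 * m) * (\sum_j s j)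
      + (3 * c ^+ 2) * (\sum_j u j) + (2 * m ^+ 3 - 3 * m ^+ 2) * K.
    rewrite !mulr_sumr mulr_natr -[in _ *+ k](card_ord k) -sumr_const.
    rewrite -!big_split; apply: eq_bigr => j _ /=; rewrite /D /F w2 c2; ring.
  rewrite ssum usum.
  have -> : B = N ^+ 3 - N * m ^+ 2 - 3 * N * (N - m).
    rewrite /B mulrBr natr_bin3 -/N -/K -/m /binom3 -mK.
    by field.
  have -> : (2 * m ^+ 3 - 3 * m ^+ 2) * K = (2 * m ^+ 2 - 3 * m) * N.
    by rewrite -mK; ring.
  by rewrite c2; ring.
have sumD0 : 0 <= \sum_j D j by rewrite sumr_ge0.
split; first lra.
move=> BP; have Dz : \sum_j D j = 0 by lra.
have {Dz} Dz j : D j = 0 by apply: (psumr_eq0P (fun j _ => D0 j) Dz).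
have sm j : s j = m by case: (tD j) => _ /(_ (Dz j))[].
have wc j : w j = c by rewrite /w sm.
(* Equality kills every square [(w j * y i - c) ^+ 2], and here [w j = c > 0]. *)
have y1 i : y i = 1.
  have [_ /(_ (Dz (f i)))[_ e]] := tD (f i).
  have : \sum_(l | f l == f i) (w (f i) * y l - c) ^+ 2 = 0.
    by rewrite sqE e subrr.
  move/(psumr_eq0P (sq0 (f i)))/(_ i (eqxx _))/eqP.
  rewrite sqrf_eq0 wc -[X in _ - X]mulr1 -mulrBr mulf_eq0 gt_eqF//=.
  by rewrite subr_eq0 => /eqP.
split=> // j; rewrite -/(u j) -/N -/K -/m -(sm j) /s.
rewrite (eq_bigr (fun=> 1)) => [|i _]; last exact: y1.
rewrite (eq_bigl [in color_class f j]) => [|i]; last by rewrite inE.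
by rewrite sumr_const.
Qed.

Lemma graph_sum_ones (R : realType) (n : nat) (G : {set {set 'I_n}})
    (y : 'I_n -> R) : (forall i, y i = 1) ->
  \sum_(e in G) \prod_(i in e) y i = #|G|%:R.
Proof.
move=> y1; rewrite -sum1_card natr_sum; apply: eq_bigr => e _.
by rewrite big1.
Qed.

Theorem theorem5 (R : realType) (k n : nat) (G : {set {set 'I_n}}) (p : R)
    (hk : (2 <= k)%N) (hG : is_3graph G) (hchr : chromatic k G)
    (hp : 1 <= p) :
  ((n <= 2 * k)%N -> G <> complete_3graph n ->
     pspectral_radius p G < 3`!%:R * 'C(n, 3)%:R * n%:R `^ (- (3 / p))) /\
  ((2 * k < n)%N -> ~ ((k %| n)%N /\ is_Q3 k G) ->
     pspectral_radius p G <
       3`!%:R * ('C(n, 3)%:R - k%:R * binom3 (n%:R / k%:R)) *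
       n%:R `^ (- (3 / p))).
Proof.
have subK : G \subset complete_3graph n.
  by apply/fintype.subsetP => e eG; rewrite inE hG.
have cardK : #|complete_3graph n| = 'C(n, 3) by rewrite card_draws card_ord.
split=> [_ nK | kn nQ].
  have ltG : (#|G| < 'C(n, 3))%N.
    by rewrite -cardK proper_card// finset.properEneq subK andbT; apply/eqP.
  (* A missing triple can exist only if ['C(n, 3)] is nonzero. *)
  have n3 : (2 < n)%N.
    by rewrite ltnNge; apply/negP => n2; rewrite bin_small in ltG.
  apply: pspectral_radius_lt => // [|y y0 yn]; first exact: ltn_trans n3.
  have [le3 eq3] := maclaurin3 R n y n3 y0 yn.
  have leG : \sum_(e in G) \prod_(i in e) y i <=
      \sum_(e : {set 'I_n} | #|e| == 3%N) \prod_(i in e) y i.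
    rewrite big_mkcond [leRHS]big_mkcond; apply: ler_sum => e _.
    case: ifPn => [/hG -> //|_]; case: ifP => // _; exact: prodr_ge0.
  rewrite ltNge; apply/negP => geG.
  have /eq3 y1 := le_trans geG (ler_wpM2l (ler0n R 6) leG).
  move: geG; rewrite (graph_sum_ones R n G y y1).
  by rewrite ler_pM2l ?ltr0n// ler_nat leqNgt ltG.
have n0 : (0 < n)%N by apply: leq_trans kn.
apply: pspectral_radius_lt => // y y0 yn; case: hchr => f hf.
have [leB eqB] := chromatic_graph_sum_le R n k G f y hk kn hG hf y0 yn.
rewrite ltNge; apply/negP => geB; have [y1 cj] := eqB geB.
have k0 : (0 < k)%N by exact: ltn_trans hk.
have cj' j : (#|color_class f j| * k = n)%N.
  apply/eqP; rewrite -(eqr_nat R) natrM cj divfK//.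
  by rewrite pnatr_eq0 -lt0n.
have kdvd : (k %| n)%N by rewrite -(cj' (Ordinal k0)) dvdn_mull.
apply: nQ; split=> //; split.
  split=> //; first by exists f.
  move=> H hH [g hg] GH; apply/eqP; rewrite eq_sym finset.eqEcard GH /=.
  (* At [y = 1] the form of a graph is six times its edge number. [G] reaches the bound there and
     [H] cannot exceed it, so [H] has no more edges than [G]. *)
  have [+ _] := chromatic_graph_sum_le R n k H g y hk kn hH hg y0 yn.
  move=> /le_trans/(_ geB).
  by rewrite !(graph_sum_ones R n _ y y1) ler_pM2l ?ltr0n// ler_nat.
exists f => // j; left.
by rewrite -[LHS](mulnK _ k0) cj'.
Qed.
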